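(* Let $\rho_1\colon\mathbb{C}^2\hookrightarrow\mathrm{SL}_2(\mathbb{C})$ be the embedding $(s,t)\mapsto\begin{pmatrix}1 & t\\ s & 1+st\end{pmatrix}$. All algebraic closed embeddings of $\mathbb{C}^2$ into $\mathrm{SL}_2(\mathbb{C})$ with image equal to $\rho_1(\mathbb{C}^2)$ are equivalent under holomorphic automorphisms of $\mathrm{SL}_2(\mathbb{C})$.
   Context: $\mathrm{SL}_2(\mathbb{C})$ is regarded as a complex manifold (and as a complex affine variety); its holomorphic automorphisms are its biholomorphic self-maps. Two embeddings $\rho,\rho'\colon\mathbb{C}^2\hookrightarrow\mathrm{SL}_2(\mathbb{C})$ are equivalent under holomorphic automorphisms if there is a holomorphic automorphism $\varphi$ of $\mathrm{SL}_2(\mathbb{C})$ with $\rho'=\varphi\circ\rho$. *)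

(* Defs.v *)
From mathcomp Require Import all_boot all_order all_algebra.
From mathcomp Require Import all_classical all_reals all_analysis.
From mathcomp Require Import complex.
From mathcomp Require mpoly.

Set Implicit Arguments.
Unset Strict Implicit.
Unset Printing Implicit Defensive.

Import Order.TTheory GRing.Theory Num.Theory.
Import numFieldNormedType.Exports.

Local Open Scope classical_set_scope.
Local Open Scope ring_scope.

(* R[i] packed as an abstract numClosedFieldType, so that it receives the
   metric topology and the normed module structure over itself that every
   numFieldType has; 'rV[Cplx R]_n and 'M[Cplx R]_n are then normed modules
   over the complex numbers and [differentiable] is complex
   differentiability. *)
Definition Cplx (R : realType) : numClosedFieldType := R[i].

Definition SL2 (R : realType) : set 'M[Cplx R]_2 := [set A | \det A = 1].

(* 2 x 2 matrices are identified with the affine space of dimension 2 * 2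
   through [mxvec]. *)
Definition entry_poly_eval (R : realType)
    (p : mpoly.mpoly (2 * 2) (Cplx R)) (A : 'M[Cplx R]_2) : Cplx R :=
  mpoly.meval (mxvec A 0) p.

Definition zariski_closed_SL2 (R : realType) (Z : set 'M[Cplx R]_2) : Prop :=
  exists S : set (mpoly.mpoly (2 * 2) (Cplx R)),
    Z = [set A | SL2 A /\ forall p, S p -> entry_poly_eval p A = 0].

Definition morphism_C2_SL2 (R : realType)
    (rho : 'rV[Cplx R]_2 -> 'M[Cplx R]_2) : Prop :=
  (forall v, SL2 (rho v)) /\
  forall i j, exists p : mpoly.mpoly 2 (Cplx R),
    forall v, rho v i j = mpoly.meval (v 0) p.

(* Regular functions on a closed subvariety Z of SL_2 are the restrictions to
   Z of polynomials in the matrix entries; the values of sigma outside Z are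
   irrelevant. *)
Definition morphism_closed_C2 (R : realType) (Z : set 'M[Cplx R]_2)
    (sigma : 'M[Cplx R]_2 -> 'rV[Cplx R]_2) : Prop :=
  forall k, exists p : mpoly.mpoly (2 * 2) (Cplx R),
    forall A, Z A -> sigma A 0 k = entry_poly_eval p A.

(* A morphism with closed image which is an isomorphism of varieties onto that
   image. *)
Definition closed_embedding_C2_SL2 (R : realType)
    (rho : 'rV[Cplx R]_2 -> 'M[Cplx R]_2) : Prop :=
  [/\ morphism_C2_SL2 rho,
      zariski_closed_SL2 (range rho) &
      exists sigma : 'M[Cplx R]_2 -> 'rV[Cplx R]_2,
        [/\ morphism_closed_C2 (range rho) sigma,
            (forall v, sigma (rho v) = v) &
            (forall A, range rho A -> rho (sigma A) = A)]].

(* Holomorphy for the structure of SL_2 as a complex submanifold of the space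
   of 2 x 2 matrices: locally on SL_2, phi is the restriction of a map which
   is holomorphic on an open set of matrices.  The values of phi outside SL_2
   are irrelevant. *)
Definition holomorphic_on_SL2 (R : realType)
    (phi : 'M[Cplx R]_2 -> 'M[Cplx R]_2) : Prop :=
  forall A, SL2 A ->
    exists G : 'M[Cplx R]_2 -> 'M[Cplx R]_2,
      \forall B \near A, differentiable G B /\ (SL2 B -> phi B = G B).

Definition holomorphic_automorphism_SL2 (R : realType)
    (phi : 'M[Cplx R]_2 -> 'M[Cplx R]_2) : Prop :=
  [/\ (forall A, SL2 A -> SL2 (phi A)),
      holomorphic_on_SL2 phi &
      exists psi : 'M[Cplx R]_2 -> 'M[Cplx R]_2,
        [/\ (forall A, SL2 A -> SL2 (psi A)),
            holomorphic_on_SL2 psi,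
            (forall A, SL2 A -> psi (phi A) = A) &
            (forall A, SL2 A -> phi (psi A) = A)]].

Definition holomorphically_equivalent (R : realType)
    (rho rho' : 'rV[Cplx R]_2 -> 'M[Cplx R]_2) : Prop :=
  exists phi, holomorphic_automorphism_SL2 phi /\
    forall v, rho' v = phi (rho v).

Definition rho1 (R : realType) (v : 'rV[Cplx R]_2) : 'M[Cplx R]_2 :=
  let s := v 0 0 in
  let t := v 0 1 in
  \matrix_(i, j) nth 0 (nth [::] [:: [:: 1; t]; [:: s; 1 + s * t]] i) j.

(* Main.v *)
Require Import Defs.
From mathcomp Require Import all_boot all_order all_algebra.
From mathcomp Require Import all_classical all_reals all_analysis.
From mathcomp Require Import complex ring.
From mathcomp Require mpoly.

Set Implicit Arguments.
Unset Strict Implicit.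
Unset Printing Implicit Defensive.

Import Order.TTheory GRing.Theory Num.Theory.
Import numFieldNormedType.Exports.

Local Open Scope classical_set_scope.
Local Open Scope ring_scope.

(* The common image is the hypersurface a = 1 of SL_2, with coordinates
   v = (s, t) = (A 1 0, A 0 1), so it suffices to extend every polynomial
   automorphism g of C^2 to a holomorphic automorphism of SL_2.  A holomorphic
   family F_a of automorphisms of C^2 with F_1 = g and F_0 = id, written
   F_a(v) = v + a G(a, v), lifts to the map (a, v) |-> (a, F_a(v)) of SL_2,
   because a divides F_a(v)_s F_a(v)_t - s t.
   - If g(0) = 0 and Dg(0) = id, take F_a(v) = g(a v) / a (Alexander's trick).
   - Translations and transvections are joined to the identity by scaling their
     parameter with a.
   - The dilation by l = exp(m) in one coordinate is joined to the identity
     through exp(a m); this is the only transcendental ingredient, and it needs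
     (exp(z) - 1) / z to be entire.
   The affine group is generated by the last two kinds, so these cases generate
   all polynomial automorphisms; Jung's theorem is not involved. *)

(** * Taylor remainders of the real exponential, sine and cosine *)

(** The mean value theorem writes [f x] as [df c * x] with [c] between [0] and [x], which costs one
    more factor [|x|]. Iterating this from a bound of order zero or one produces the Taylor
    estimates below. *)
Lemma le_normr_power_of_derive (R : realType) (f df : R -> R) (K : R) (n : nat) :
  (forall x : R, is_derive x 1 f (df x)) -> f 0 = 0 ->
  (forall x, `|x| <= 1 -> `|df x| <= K * `|x| ^+ n) ->
  forall x, `|x| <= 1 -> `|f x| <= K * `|x| ^+ n.+1.
Proof.
move=> fdf f0 dfK x x1.
have fcont a b : {within `[a, b], continuous f}.
  apply: derivable_within_continuous => y _.
  by have [] := fdf y.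
have K0 : 0 <= K.
  have := dfK 1; rewrite normr1 lexx expr1n mulr1 => /(_ isT).
  exact: le_trans.
have step c : `|c| <= `|x| -> `|df c * x| <= K * `|x| ^+ n.+1.
  move=> cx; rewrite normrM exprSr mulrA ler_wpM2r//.
  apply: (le_trans (dfK _ (le_trans cx x1))).
  by rewrite ler_wpM2l// lerXn2r// ?nnegrE.
have [x0|x0] := leP 0 x.
  have [c] := MVT_segment x0 (fun y _ => fdf y) (fcont _ _).
  rewrite in_itv/= f0 !subr0 => /andP[c0 cx] ->.
  by apply: step; rewrite !ger0_norm.
have [c] := MVT_segment (ltW x0) (fun y _ => fdf y) (fcont _ _).
rewrite in_itv/= f0 !sub0r => /andP[xc c0] fx.
rewrite -[`|f x|]normrN fx -[`|_ * _|]normrN mulrN opprK.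
by apply: step; rewrite !ler0_norm ?lerN2// ltW.
Qed.

Section taylor.
Variable R : realType.
Implicit Types x : R.

Lemma expR_bound0 x : `|x| <= 1 -> `|expR x| <= expR 1 * `|x| ^+ 0.
Proof.
by rewrite expr0 mulr1 (ger0_norm (expR_ge0 _)) ler_expR => /ler_normlP[].
Qed.

Lemma expR_bound1 x : `|x| <= 1 -> `|expR x - 1| <= expR 1 * `|x| ^+ 1.
Proof.
apply: (@le_normr_power_of_derive _ (fun x => expR x - 1) expR).
- move=> y; apply: is_derive_eq.
  by rewrite subr0.
- by rewrite expR0 subrr.
- exact: expR_bound0.
Qed.

Lemma expR_bound2 x : `|x| <= 1 -> `|expR x - 1 - x| <= expR 1 * `|x| ^+ 2.
Proof.
apply: (@le_normr_power_of_derive _ (fun x => expR x - 1 - x)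
  (fun x => expR x - 1)).
- by move=> y; apply: is_derive_eq; rewrite subr0.
- by rewrite expR0 subrr subr0.
- exact: expR_bound1.
Qed.

Lemma expR_bound3 x :
  `|x| <= 1 -> `|expR x - 1 - x - x ^+ 2 / 2| <= expR 1 * `|x| ^+ 3.
Proof.
apply: (@le_normr_power_of_derive _ (fun x => expR x - 1 - x - x ^+ 2 / 2)
  (fun x => expR x - 1 - x)).
- move=> y; apply: is_derive_eq; rewrite subr0.
  rewrite /GRing.scale/=; by field.
- by rewrite expR0 subrr subr0 expr0n mul0r subr0.
- exact: expR_bound2.
Qed.

Lemma sin_bound1 x : `|x| <= 1 -> `|sin x| <= 1 * `|x| ^+ 1.
Proof.
apply: (@le_normr_power_of_derive _ sin cos); first exact: sin0.
by move=> y _; rewrite mulr1 ler_norml cos_geN1 cos_le1.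
Qed.

Lemma cos_bound2 x : `|x| <= 1 -> `|cos x - 1| <= 1 * `|x| ^+ 2.
Proof.
apply: (@le_normr_power_of_derive _ (fun x => cos x - 1) (fun x => - sin x)).
- by move=> y; apply: is_derive_eq; rewrite subr0.
- by rewrite cos0 subrr.
- by move=> y; rewrite normrN; exact: sin_bound1.
Qed.

Lemma sin_bound3 x : `|x| <= 1 -> `|sin x - x| <= 1 * `|x| ^+ 3.
Proof.
apply: (@le_normr_power_of_derive _ (fun x => sin x - x) (fun x => cos x - 1)).
- by rewrite sin0 subrr.
- exact: cos_bound2.
Qed.

Lemma cos_bound4 x : `|x| <= 1 -> `|cos x - 1 + x ^+ 2 / 2| <= 1 * `|x| ^+ 4.
Proof.
apply: (@le_normr_power_of_derive _ (fun x => cos x - 1 + x ^+ 2 / 2)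
  (fun x => - (sin x - x))).
- move=> y; apply: is_derive_eq; rewrite subr0 /GRing.scale/=; by field.
- by rewrite cos0 subrr expr0n mul0r addr0.
- by move=> y; rewrite normrN; exact: sin_bound3.
Qed.

End taylor.

(** * The complex exponential and the entire function [(exp z - 1) / z] *)

Section complex_exponential.
Local Open Scope complex_scope.

Definition cexp (R : realType) (z : Cplx R) : Cplx R :=
  (expR (complex.Re z))%:C * (cos (complex.Im z) +i* sin (complex.Im z)).

Lemma cexp0 (R : realType) : cexp (0 : Cplx R) = 1.
Proof. by rewrite /cexp /= expR0 cos0 sin0 mul1r. Qed.

Lemma cexpD (R : realType) (z w : Cplx R) : cexp (z + w) = cexp z * cexp w.
Proof.
case: z w => [a b] [c d]; rewrite /cexp /= expRD cosD sinD.
by apply/eqP; rewrite eq_complex /=; apply/andP; split; apply/eqP; ring.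
Qed.

(** Polar coordinates: the logarithm has real part [ln r] and imaginary part an argument of [z]. *)
Lemma cexp_surj (R : realType) (z : Cplx R) : z != 0 -> exists w, cexp w = z.
Proof.
case: z => x y; rewrite eq_complex /= negb_and => xy0.
set r := Num.sqrt (x ^+ 2 + y ^+ 2).
have r2 : r ^+ 2 = x ^+ 2 + y ^+ 2 by rewrite sqr_sqrtr// addr_ge0 ?sqr_ge0.
have r_gt0 : 0 < r.
  rewrite sqrtr_gt0; case/orP: xy0 => h.
    by rewrite ltr_wpDr ?sqr_ge0// exprn_even_gt0.
  by rewrite ltr_wpDl ?sqr_ge0// exprn_even_gt0.
have r_neq0 : r != 0 by rewrite gt_eqF.
have xr : -1 <= x / r <= 1.
  rewrite -ler_norml normrM normfV (gtr0_norm r_gt0) ler_pdivrMr// mul1r.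
  by rewrite -sqrtr_sqr ler_wsqrtr// lerDl sqr_ge0.
have yr : Num.sqrt (1 - (x / r) ^+ 2) = `|y| / r.
  have -> : 1 - (x / r) ^+ 2 = (`|y| / r) ^+ 2.
    rewrite !expr_div_n real_normK ?num_real//.
    rewrite -[X in X - _](@divff _ (r ^+ 2)) ?expf_neq0//.
    by rewrite -mulrBl r2 addrC addKr.
  by rewrite sqrtr_sqr ger0_norm// divr_ge0// ltW.
(* [acos] takes values where the sine is nonnegative, so the lower half-plane needs the opposite
   angle. *)
have [t [ct st]] : exists t, cos t = x / r /\ sin t = y / r.
  have [y0|y0] := leP 0 y.
    exists (acos (x / r)); split; first by rewrite acosK// in_itv.
    by rewrite sin_acos// yr ger0_norm.
  exists (- acos (x / r)); split; first by rewrite cosN acosK// in_itv.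
  by rewrite sinN sin_acos// yr ltr0_norm// mulNr opprK.
exists (ln r +i* t); rewrite /cexp /= lnK ?posrE// ct st.
by apply/eqP; rewrite eq_complex /=; apply/andP; split; apply/eqP; field.
Qed.

Lemma ler_normC_coord (R : realType) (z : Cplx R) :
  `|(complex.Re z)%:C : Cplx R| <= `|z| /\ `|(complex.Im z)%:C : Cplx R| <= `|z|.
Proof.
rewrite !normc_def /= !expr0n !addr0 !lecR; split; apply: ler_wsqrtr.
  by rewrite lerDl sqr_ge0.
by rewrite lerDr sqr_ge0.
Qed.

Lemma normc_realE (R : realType) (x : R) : `|x%:C : Cplx R| = `|x|%:C.
Proof. by rewrite normc_def /= expr0n addr0 sqrtr_sqr. Qed.

(** The order is three because [(exp z - 1) / z] loses one power of [h] at the origin and must still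
    have a quadratic remainder. With [h = u + w], [u] real and [w] imaginary, the bound comes from
    multiplying the expansions of [exp u] and [exp w]. *)
Lemma cexp_bound3 (R : realType) : exists2 K : Cplx R, 0 < K &
  forall h : Cplx R, `|h| <= 1 ->
    `|cexp h - 1 - h - h ^+ 2 / 2| <= K * `|h| ^+ 3.
Proof.
have e0 : 0 <= (expR 1 : R)%:C :> Cplx R by rewrite ler0c expR_ge0.
(* [expR 1] bounds the error in [exp u]; [6 = 3 * 2] is the bound [3] on the quadratic polynomial in
   [u] times the error constant [2] for [exp w]; the last [2] covers the mixed terms of degree at
   least three. *)
exists ((expR 1)%:C + 6 + 2); first by rewrite ltr_wpDl// addr_ge0.
move=> h h1; have [uh wh] := ler_normC_coord h.
set x := complex.Re h in uh; set y := complex.Im h in wh.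
have x1 : `|x| <= 1.
  by have := le_trans uh h1; rewrite normc_realE -[1]/(1%:C) lecR.
have y1 : `|y| <= 1.
  by have := le_trans wh h1; rewrite normc_realE -[1]/(1%:C) lecR.
set u : Cplx R := x%:C in uh *.
set w : Cplx R := 0 +i* y.
have wE : `|w| = `|(y%:C : Cplx R)|.
  by rewrite !normc_def /= !expr0n addr0 add0r.
have hE : h = u + w.
  by rewrite /u /w /x /y; case: (h) => a b; apply/eqP;
     rewrite eq_complex /= addr0 add0r !eqxx.
rewrite -wE in wh.
set EX : Cplx R := (expR x)%:C.
set CS : Cplx R := cos y +i* sin y.
have -> : cexp h = EX * CS by [].
have powh (a : Cplx R) n : `|a| <= `|h| -> `|a| ^+ n <= `|h| ^+ n.
  by move=> ah; rewrite lerXn2r ?nnegrE.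
have h3 (a b : Cplx R) : `|a| <= `|h| -> `|b| <= `|h| ->
    `|a * b ^+ 2| <= `|h| ^+ 3.
  by move=> ah bh; rewrite normrM normrX [leRHS]exprS ler_pM ?exprn_ge0// powh.
have uw1 : `|u| <= 1 /\ `|w| <= 1 by split; exact: le_trans h1.
have EXb : `|EX - (1 + u + u ^+ 2 / 2)| <= (expR 1)%:C * `|h| ^+ 3.
  have -> : EX - (1 + u + u ^+ 2 / 2) = (expR x - 1 - x - x ^+ 2 / 2)%:C.
    by rewrite /EX /u !(rmorphB, rmorphM, rmorphXn, fmorphV, rmorph1, rmorph_nat)/=; ring.
  apply: (@le_trans _ _ ((expR 1)%:C * `|u| ^+ 3)); last first.
    by rewrite ler_wpM2l// powh.
  by rewrite !normc_realE -rmorphXn -rmorphM lecR expR_bound3.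
have CSb : `|CS - (1 + w + w ^+ 2 / 2)| <= 2 * `|h| ^+ 3.
  have -> : CS - (1 + w + w ^+ 2 / 2) =
      (cos y - 1 + y ^+ 2 / 2)%:C + 'i%C * (sin y - y)%:C.
    have -> : w ^+ 2 = (- y ^+ 2)%:C.
      by apply/eqP; rewrite eq_complex /=; apply/andP; split; apply/eqP; ring.
    have -> : (- y ^+ 2)%:C / 2 = (- y ^+ 2 / 2)%:C :> Cplx R.
      by rewrite rmorphM fmorphV rmorph_nat.
    by apply/eqP; rewrite eq_complex /=; apply/andP; split; apply/eqP; ring.
  rewrite [in leRHS]mulr2n [leRHS]mulrDl mul1r (le_trans (ler_normD _ _))// lerD//.
    apply: (@le_trans _ _ (`|w| ^+ 3)); last exact: powh.
    rewrite wE !normc_realE -rmorphXn lecR.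
    apply: le_trans (cos_bound4 y1) _.
    by rewrite mul1r exprSr ler_piMr.
  apply: (@le_trans _ _ (`|w| ^+ 3)); last exact: powh.
  have -> : `|'i%C * (sin y - y)%:C : Cplx R| = `|sin y - y|%:C.
    rewrite normrM normc_realE normc_def /=.
    by rewrite expr0n expr1n add0r sqrtr1 mul1r.
  by rewrite wE normc_realE -rmorphXn lecR -[leRHS]mul1r sin_bound3.
have CS1 : `|CS| = 1 by rewrite normc_def /= cos2Dsin2 sqrtr1.
have P3 : `|1 + u + u ^+ 2 / 2| <= 3.
  have -> : 3 = 1 + 1 + 1 :> Cplx R by ring.
  rewrite (le_trans (ler_normD _ _))// lerD//.
    by rewrite (le_trans (ler_normD _ _))// lerD ?normr1//; case: uw1.
  rewrite normrM normrX normfV [`|2|]ger0_norm// ler_pdivrMr// mul1r.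
  by rewrite (@le_trans _ _ 1)// ?exprn_ile1// ?ler1n//; case: uw1.
(* The last bracket is what the product of the two quadratic Taylor polynomials contains beyond
   [1 + h + h ^+ 2 / 2]. *)
have -> : EX * CS - 1 - h - h ^+ 2 / 2 =
    (EX - (1 + u + u ^+ 2 / 2)) * CS + (1 + u + u ^+ 2 / 2) * (CS - (1 + w + w ^+ 2 / 2))
    + (u * w ^+ 2 * (2^-1 + u / 4) + w * u ^+ 2 / 2).
  by rewrite hE; field.
rewrite [leRHS]mulrDl [X in _ <= X + _]mulrDl (le_trans (ler_normD _ _))// lerD//.
  rewrite (le_trans (ler_normD _ _))// lerD//.
    by rewrite normrM CS1 mulr1.
  rewrite normrM (_ : 6 = 3 * 2 :> Cplx R); last by ring.
  by rewrite -mulrA ler_pM.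
rewrite [in leRHS]mulr2n [leRHS]mulrDl mul1r (le_trans (ler_normD _ _))// lerD//.
  rewrite normrM -[leRHS]mulr1 ler_pM ?h3//.
  rewrite [leRHS](_ : 1 = 2^-1 + 2^-1); last by field.
  rewrite (le_trans (ler_normD _ _))// lerD//.
    by rewrite ger0_norm.
  rewrite normrM -[leRHS]mul1r ler_pM//; first by case: uw1.
  by rewrite ger0_norm// lef_pV2 ?posrE// ler_nat.
rewrite normrM -[leRHS]mulr1 ler_pM ?h3//.
by rewrite ger0_norm// invf_le1 ?ler1n.
Qed.

(** The difference quotient is within [K * |h|] of [l], so [l] is the derivative at [z]. *)
Lemma differentiable_quadratic_remainder (R : realType) (f : Cplx R -> Cplx R)
    (z l K : Cplx R) : 0 < K ->
  (forall h, `|h| <= 1 -> `|f (h + z) - f z - h * l| <= K * `|h| ^+ 2) ->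
  differentiable f z.
Proof.
move=> K0 fK; apply/derivable1_diffP/cvg_ex; exists l.
apply/cvgrPdist_le => e e0.
near=> h.
have h0 : h != 0 by near: h; exact: nbhs_dnbhs_neq.
have h1 : `|h| <= 1.
  near: h; apply: dnbhs0_le; exact: ltr01.
have he : `|h| <= e / K.
  near: h; apply: dnbhs0_le; exact: divr_gt0.
have -> : l - h^-1 *: ((f \o shift z) (h *: 1) - f z) =
    - (h^-1 * (f (h + z) - f z - h * l)).
  rewrite /= /GRing.scale /= mulr1; field.
  exact: h0.
rewrite normrN normrM normfV ler_pdivrMl ?normr_gt0//.
apply: (le_trans (fK _ h1)).
by rewrite expr2 mulrCA ler_wpM2l// -ler_pdivlMl// mulrC.
Unshelve. all: by end_near. Qed.

(** The functional equation moves the estimate from [z] to the origin. *)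
Lemma cexp_differentiable (R : realType) (z : Cplx R) : differentiable (@cexp R) z.
Proof.
have [K K0 hK] := cexp_bound3 R.
(* In [K + 1], [K] absorbs the cubic remainder and [1] the term [h ^+ 2 / 2]; adding [1] to
   [|cexp z|] makes the constant visibly positive. *)
apply: (@differentiable_quadratic_remainder _ _ _ (cexp z)
  ((1 + `|cexp z|) * (K + 1))).
  by rewrite mulr_gt0 ?ltr_wpDr ?addr_gt0.
move=> h h1.
have -> : cexp (h + z) - cexp z - h * cexp z =
    cexp z * ((cexp h - 1 - h - h ^+ 2 / 2) + h ^+ 2 / 2).
  by rewrite cexpD; ring.
rewrite normrM -[leRHS]mulrA ler_pM//; first by rewrite lerDr.
rewrite [leRHS]mulrDl (le_trans (ler_normD _ _))// lerD//.
  apply: (le_trans (hK _ h1)); rewrite ler_wpM2l ?(ltW K0)//.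
  by rewrite exprSr ler_piMr ?exprn_ge0.
rewrite normrM normrX mulrC ler_wpM2r ?exprn_ge0//.
by rewrite ger0_norm// invf_le1 ?ler1n.
Qed.

(** The value [1] at the origin fills the removable singularity. *)
Definition expm1_div (R : realType) (z : Cplx R) : Cplx R :=
  if z == 0 then 1 else (cexp z - 1) / z.

Lemma mul_expm1_div (R : realType) (z : Cplx R) : z * expm1_div z = cexp z - 1.
Proof.
rewrite /expm1_div; have [->|z0] := eqVneq z 0; first by rewrite mul0r cexp0 subrr.
by rewrite mulrCA mulrV ?mulr1 ?unitfE.
Qed.

(** This identity makes the shears extending a dilation and its inverse mutually inverse. *)
Lemma expm1_divN (R : realType) (z : Cplx R) :
  expm1_div (- z) * cexp z = expm1_div z.
Proof.
rewrite /expm1_div oppr_eq0; have [->|z0] := eqVneq z 0.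
  by rewrite cexp0 mulr1.
have : cexp (- z) * cexp z = 1 by rewrite -cexpD addNr cexp0.
move=> e; have -> : (cexp (- z) - 1) / - z * cexp z =
   (cexp (- z) * cexp z - cexp z) / - z by rewrite mulrAC mulrBl mul1r.
rewrite e; field.
exact: z0.
Qed.

(** At the origin, dividing the cubic bound on [cexp] by [h] leaves a quadratic remainder with
    derivative [2^-1]. Elsewhere the function agrees locally with a quotient of differentiable
    functions. *)
Lemma expm1_div_differentiable (R : realType) (z : Cplx R) :
  differentiable (@expm1_div R) z.
Proof.
have [->|z0] := eqVneq z 0.
  have [K K0 hK] := cexp_bound3 R.
  apply: (@differentiable_quadratic_remainder _ _ _ 2^-1 K) => // h h1.
  rewrite addr0 /expm1_div eqxx; have [->|h0] := eqVneq h 0.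
    by rewrite subrr mul0r subr0 normr0 mulr_ge0// ltW.
  have -> : (cexp h - 1) / h - 1 - h * 2^-1 = (cexp h - 1 - h - h ^+ 2 / 2) / h.
    by field; exact: h0.
  rewrite normrM normfV ler_pdivrMr ?normr_gt0// -[leRHS]mulrA -exprSr.
  exact: hK.
have dq : differentiable ((@cexp R - cst 1) * (@GRing.inv (Cplx R))) z.
  apply: differentiableM; last exact: differentiable_Rinv.
  apply: differentiableB; last exact: differentiable_cst.
  exact: cexp_differentiable.
apply/derivable1_diffP; move/derivable1_diffP: dq.
apply: near_eq_derivable.
near=> w.
have w0 : w != 0.
  near: w; apply: open_nbhs_nbhs; split => //.
  have := @norm_hausdorff _ (Cplx R).
  move/hausdorff_accessible/accessible_closed_set1 => /(_ 0) /closed_openC.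
  rewrite (_ : ~` _ = (fun w => w != 0))//.
  by apply/funext => x; apply/propext; split => /eqP.
by rewrite /expm1_div (negbTE w0).
Unshelve. all: by end_near. Qed.

End complex_exponential.

(** * Algebra of 2 by 2 matrices *)

Lemma ord2P (i : 'I_2) : i = 0 \/ i = 1.
Proof. by case: i => [[|[|//]] ?]; [left|right]; exact: val_inj. Qed.

Lemma rowP2 (T : Type) (u v : 'rV[T]_2) : u 0 0 = v 0 0 -> u 0 1 = v 0 1 -> u = v.
Proof. by move=> e0 e1; apply/rowP => j; case: (ord2P j) => ->. Qed.

Lemma matrixP2 (T : Type) (A B : 'M[T]_2) :
  A 0 0 = B 0 0 -> A 0 1 = B 0 1 -> A 1 0 = B 1 0 -> A 1 1 = B 1 1 -> A = B.
Proof.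
move=> e00 e01 e10 e11; apply/matrixP => i j.
by case: (ord2P i) => ->; case: (ord2P j) => ->.
Qed.

Lemma mulmx2E (K : pzSemiRingType) m n (A : 'M[K]_(m, 2)) (B : 'M[K]_(2, n)) i j :
  (A *m B) i j = A i 0 * B 0 j + A i 1 * B 1 j.
Proof.
rewrite mxE big_ord_recl big_ord1; congr (_ + A i _ * B _ j); exact: val_inj.
Qed.

Lemma det_mx22 (K : comPzRingType) (A : 'M[K]_2) :
  \det A = A 0 0 * A 1 1 - A 0 1 * A 1 0.
Proof.
rewrite (expand_det_row _ 0) big_ord_recl big_ord1 /cofactor !det_mx11 !mxE /=.
rewrite expr0 expr1 mul1r mulN1r mulrN.
by congr (_ * A _ _ - A _ _ * A _ _); exact: val_inj.
Qed.

(** The two diagonal entries dictate the outer transvections; the upper right entry then agrees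
    because the determinant is [1]. *)
Lemma det1_mx22_factor (K : fieldType) (S : 'M[K]_2) :
  \det S = 1 -> S 1 0 != 0 ->
  S = (1%:M + ((S 0 0 - 1) / S 1 0) *: delta_mx 0 1) *m
      (1%:M + S 1 0 *: delta_mx 1 0) *m
      (1%:M + ((S 1 1 - 1) / S 1 0) *: delta_mx 0 1).
Proof.
rewrite det_mx22 => detS S10.
have S01 : S 0 1 = (S 0 0 * S 1 1 - 1) / S 1 0.
  by apply: (mulIf S10); rewrite mulrVK ?unitfE// -detS; ring.
by apply: matrixP2; rewrite ?S01 !mulmx2E !mxE /=; field.
Qed.

Lemma mx22_shear_rows (K : comPzRingType) (S : 'M[K]_2) :
  S = (1%:M + (- 1) *: delta_mx 1 0) *m ((1%:M + 1 *: delta_mx 1 0) *m S).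
Proof. by apply: matrixP2; rewrite !mulmx2E !mxE /=; ring. Qed.

(** For [l = \det L] the remaining factor has determinant [1]. *)
Lemma mx22_dilation_factor (K : fieldType) (l : K) (L : 'M[K]_2) : l != 0 ->
  L = (1%:M + (l - 1) *: delta_mx 0 0) *m
      ((1%:M + (l^-1 - 1) *: delta_mx 0 0) *m L).
Proof. by move=> l0; apply: matrixP2; rewrite !mulmx2E !mxE /=; field. Qed.

Lemma det_dilation (K : comPzRingType) (l : K) :
  \det (1%:M + (l - 1) *: delta_mx 0 0 : 'M[K]_2) = l.
Proof. by rewrite det_mx22 !mxE /=; ring. Qed.

Lemma det_lower_transvection (K : comPzRingType) (x : K) :
  \det (1%:M + x *: delta_mx 1 0 : 'M[K]_2) = 1.
Proof. by rewrite det_mx22 !mxE /=; ring. Qed.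

(** * Differentiability of matrix-valued maps *)

Section differentiable_matrices.
Variables (K : numFieldType) (U : normedModType K).
Implicit Types x : U.

Lemma differentiable_mx m n (f : U -> 'M[K]_(m.+1, n.+1)) x :
  (forall i j, differentiable (fun y => f y i j) x) -> differentiable f x.
Proof.
move=> df; have -> : f = \sum_i \sum_j (fun y => f y i j *: delta_mx i j).
  apply/funext => y; rewrite [LHS]matrix_sum_delta fct_sumE.
  by apply: eq_bigr => i _; rewrite fct_sumE.
apply: differentiable_sum => i; apply: differentiable_sum => j.
exact: differentiableZl.
Qed.

Lemma differentiable_entry m n (f : U -> 'M[K]_(m.+1, n.+1)) x i j :
  differentiable f x -> differentiable (fun y => f y i j) x.
Proof.
move=> df; apply: (@differentiable_comp _ _ _ _ f (fun N => N i j)) => //.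
exact: differentiable_coord.
Qed.

Lemma differentiable_scale_mx m n (k : U -> K) (f : U -> 'M[K]_(m.+1, n.+1)) x :
  differentiable k x -> differentiable f x ->
  differentiable (fun y => k y *: f y) x.
Proof.
move=> dk df; apply: differentiable_mx => i j.
under eq_fun do rewrite mxE.
by apply: differentiableM => //; exact: differentiable_entry.
Qed.

Lemma differentiable_mulmxr m n (f : U -> 'M[K]_(m.+1, 2)) (B : 'M[K]_(2, n.+1)) x :
  differentiable f x -> differentiable (fun y => f y *m B) x.
Proof.
move=> df; apply: differentiable_mx => i j.
under eq_fun do rewrite mulmx2E.
by apply: differentiableD; apply: differentiableM;
  [exact: differentiable_entry|exact: differentiable_cst|
   exact: differentiable_entry|exact: differentiable_cst].
Qed.

End differentiable_matrices.

(** * Shears of the matrix space, and the affine maps of the plane they extend *)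

Section shears.
Variable R : realType.
Local Notation C := (Cplx R).
Implicit Types (A B : 'M[C]_2) (u v w : 'rV[C]_2) (G H : 'M[C]_2 -> 'rV[C]_2).

Definition row_st A : 'rV[C]_2 := \row_j (if j == 0 then A 1 0 else A 0 1).

Definition mx_st (a : C) w (d : C) : 'M[C]_2 := \matrix_(i, j)
  (if i == 0 then if j == 0 then a else w 0 1 else if j == 0 then w 0 0 else d).

Lemma row_st_mx_st a w d : row_st (mx_st a w d) = w.
Proof. by apply: rowP2; rewrite !mxE. Qed.

Lemma rho1E v : rho1 v = mx_st 1 v (1 + v 0 0 * v 0 1).
Proof. by apply: matrixP2; rewrite !mxE. Qed.

Lemma row_st_rho1 v : row_st (rho1 v) = v.
Proof. by rewrite rho1E row_st_mx_st. Qed.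

Lemma det_mx_st a w d : \det (mx_st a w d) = a * d - w 0 0 * w 0 1.
Proof. by rewrite det_mx22 !mxE /= [w 0 1 * _]mulrC. Qed.

Lemma differentiable_row_st A : differentiable row_st A.
Proof.
apply: differentiable_mx => i j; rewrite (ord1 i).
by case: (ord2P j) => ->; under eq_fun do rewrite mxE;
  exact: differentiable_coord.
Qed.

Lemma differentiable_mx_st (U : normedModType C) (a d : U -> C)
    (w : U -> 'rV[C]_2) x :
  differentiable a x -> differentiable w x -> differentiable d x ->
  differentiable (fun y => mx_st (a y) (w y) (d y)) x.
Proof.
move=> da dw dd; apply: differentiable_mx => i j.
by case: (ord2P i) => ->; case: (ord2P j) => ->; under eq_fun do rewrite mxE //=;
  try exact: differentiable_entry.
Qed.

(** Matrices with nonzero upper left entry are dense: [A + t *: delta_mx 0 0] tends to [A] through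
    them. Identities can thus be proved after cancelling [A 0 0]. *)
Lemma eq0_of_generic (F : 'M[C]_2 -> 'rV[C]_2) :
  (forall A, differentiable F A) -> (forall A, A 0 0 != 0 -> F A = 0) ->
  forall A, F A = 0.
Proof.
move=> dF F0 A; have [A0|A0] := eqVneq (A 0 0) 0; last exact: F0.
apply/eqP/negPn/negP => FA0.
pose line (t : C) := A + t *: delta_mx 0 0.
have dline : differentiable line 0.
  apply: differentiableD; first exact: differentiable_cst.
  exact: differentiableZl.
have cont : {for (0 : C), continuous (F \o line)}.
  by apply: differentiable_continuous; exact: differentiable_comp.
have opn : open (~` [set 0 : 'rV[C]_2]).
  apply: closed_openC; apply: accessible_closed_set1.
  exact/hausdorff_accessible/norm_hausdorff.
have nU : nbhs (F (line 0)) (~` [set 0]).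
  apply: open_nbhs_nbhs; split => //=.
  by rewrite /line scale0r addr0; apply/eqP.
have nF : \forall t \near (0 : C), F (line t) <> 0 by exact: (cont _ nU).
have : \forall t \near (0 : C)^', False.
  near=> t.
  have t0 : t != 0 by near: t; exact: nbhs_dnbhs_neq.
  have : F (line t) <> 0 by near: t; exact: nbhs_dnbhs.
  by apply; rewrite F0// !mxE A0 add0r mulr1.
by move/filter_ex => [].
Unshelve. all: by end_near. Qed.

(* The lower right entry is the one that keeps the determinant equal to
   [\det A]; no division by [A 0 0] is needed. *)
Definition shear G A : 'M[C]_2 :=
  mx_st (A 0 0) (row_st A + A 0 0 *: G A)
    (A 1 1 + A 1 0 * G A 0 1 + A 0 1 * G A 0 0 + A 0 0 * (G A 0 0 * G A 0 1)).

Lemma det_shear G A : \det (shear G A) = \det A.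
Proof. by rewrite det_mx_st det_mx22 !mxE /=; ring. Qed.

Lemma shear_rho1 G v : shear G (rho1 v) = rho1 (v + G (rho1 v)).
Proof.
rewrite /shear row_st_rho1; apply: matrixP2; rewrite !mxE //= ?mul1r//.
by ring.
Qed.

(** Both shears keep [A 0 0], so opposite displacements cancel off the diagonal; in the lower right
    entry the cancellation is a polynomial identity, valid also for [A 0 0 = 0]. *)
Lemma shearK G H A : H (shear G A) = - G A -> shear H (shear G A) = A.
Proof.
by move=> HG; rewrite {1}/shear HG; apply: matrixP2; rewrite !mxE /=; ring.
Qed.

Lemma differentiable_shear G A :
  differentiable G A -> differentiable (shear G) A.
Proof.
move=> dG; have dG' i : differentiable (fun B => G B 0 i) A.
  exact: differentiable_entry.
have dA i j : differentiable (fun B : 'M[C]_2 => B i j) A.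
  exact: differentiable_coord.
apply: (differentiable_mx_st (dA 0 0)).
  apply: differentiableD; first exact: differentiable_row_st.
  by apply: (differentiable_scale_mx (dA 0 0)).
apply: differentiableD.
  apply: differentiableD.
    apply: differentiableD; first exact: dA.
    by apply: (differentiableM (dA 1 0)).
  by apply: (differentiableM (dA 0 1)).
by apply: (differentiableM (dA 0 0)); apply: differentiableM.
Qed.

(** The extension is an automorphism of the whole matrix space preserving the determinant, so that
    differentiability and density arguments take place in a vector space; it restricts to the level
    set [\det A = 1]. *)
Definition extendable (g : 'rV[C]_2 -> 'rV[C]_2) : Prop :=
  exists phi psi : 'M[C]_2 -> 'M[C]_2,
    [/\ (forall A, differentiable phi A) /\ (forall A, differentiable psi A),
        cancel phi psi, cancel psi phi,
        forall A, \det (phi A) = \det A &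
        forall v, phi (rho1 v) = rho1 (g v)].

Lemma extendable_comp f g : extendable f -> extendable g -> extendable (g \o f).
Proof.
move=> [p [p' [[dp dp'] pK p'K detp pE]]] [q [q' [[dq dq'] qK q'K detq qE]]].
exists (q \o p), (p' \o q'); split.
- by split => A; exact: differentiable_comp.
- exact: can_comp.
- exact: can_comp.
- by move=> A /=; rewrite detq.
- by move=> v /=; rewrite pE qE.
Qed.

(** The inverse relations are only tested where [A 0 0] can be cancelled; [eq0_of_generic] extends
    them to all matrices and [shearK] turns them into inverses. *)
Lemma extendable_shear G H g :
  (forall A, differentiable G A) -> (forall A, differentiable H A) ->
  (forall A, A 0 0 != 0 -> H (shear G A) = - G A) ->
  (forall A, A 0 0 != 0 -> G (shear H A) = - H A) ->
  (forall v, g v = v + G (rho1 v)) -> extendable g.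
Proof.
have ext G1 H1 : (forall A, differentiable G1 A) ->
    (forall A, differentiable H1 A) ->
    (forall A, A 0 0 != 0 -> H1 (shear G1 A) = - G1 A) ->
    forall A, H1 (shear G1 A) = - G1 A.
  move=> dG dH HG A; apply/eqP; rewrite -addr_eq0; apply/eqP; move: A.
  apply: eq0_of_generic => A.
    apply: differentiableD => //; apply: differentiable_comp => //.
    exact: differentiable_shear.
  by move=> A0; rewrite HG// addNr.
move=> dG dH HG GH gE; exists (shear G), (shear H); split.
- by split => A; exact: differentiable_shear.
- by move=> A; apply/shearK/ext.
- by move=> A; apply/shearK/ext.
- exact: det_shear.
- by move=> v; rewrite shear_rho1 gE.
Qed.

Lemma extendable_translation u : extendable (+%R^~ u).
Proof.
have dcst w A : differentiable (cst w : 'M[C]_2 -> 'rV[C]_2) A.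
  exact: differentiable_cst.
apply: (@extendable_shear (cst u) (cst (- u))) => // A _.
by rewrite opprK.
Qed.

Lemma row_st_shear G A : row_st (shear G A) = row_st A + A 0 0 *: G A.
Proof. exact: row_st_mx_st. Qed.

(** Since [N *m N = 0], the displacement [row_st A *m N] is unchanged by its own shear, and the
    shear of [- N] undoes it. *)
Lemma extendable_nilpotent (N : 'M[C]_2) :
  N *m N = 0 -> extendable (mulmxr (1%:M + N)).
Proof.
move=> NN.
have dN (M : 'M[C]_2) A : differentiable (fun A => row_st A *m M) A.
  exact/differentiable_mulmxr/differentiable_row_st.
apply: (@extendable_shear (fun A => row_st A *m N) (fun A => row_st A *m - N)) => // [A _|A _|v].
- rewrite row_st_shear mulmxN mulmxDl -scalemxAl -mulmxA NN.
  by rewrite mulmx0 scaler0 addr0.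
- rewrite row_st_shear mulmxN opprK mulmxDl -scalemxAl mulNmx -mulmxA NN.
  by rewrite mulmx0 oppr0 scaler0 addr0.
- by rewrite row_st_rho1 /= mulmxDr mulmx1.
Qed.

Lemma extendable_dilation (l : C) : l != 0 ->
  extendable (mulmxr (1%:M + (l - 1) *: delta_mx 0 0)).
Proof.
move=> l0; have [m lE] := cexp_surj l0.
set E : 'M[C]_2 := delta_mx 0 0.
have EE : E *m E = E by rewrite mul_delta_mx.
(* With [a = A 0 0], [a *: D c A] is [cexp (a * c) - 1] times the first coordinate, so [shear (D c)]
   multiplies that coordinate by [cexp (a * c)]. *)
pose D (c : C) A := (c * expm1_div (A 0 0 * c)) *: (row_st A *m E).
have dD c A : differentiable (D c) A.
  apply: differentiable_scale_mx; last first.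
    exact/differentiable_mulmxr/differentiable_row_st.
  apply: differentiableM; first exact: differentiable_cst.
  apply: (@differentiable_comp _ _ _ _ (fun A : 'M[C]_2 => A 0 0 * c)).
    apply: differentiableM; last exact: differentiable_cst.
    exact: differentiable_coord.
  exact: expm1_div_differentiable.
have DD c A : D (- c) (shear (D c) A) = - D c A.
  rewrite {1}/D row_st_shear [shear _ _ 0 0]mxE /= mulmxDl -scalemxAl.
  rewrite -[(D c A) *m E]scalemxAl -mulmxA EE [A 0 0 *: _]scalerA mulrA.
  rewrite mul_expm1_div -{1}[row_st A *m E]scale1r -scalerDl addrC subrK scalerA.
  rewrite mulrN -mulrA expm1_divN mulNr scaleNr.
  by [].
apply: (@extendable_shear (D m) (D (- m))) => // [A _|v].
  by have := DD (- m) A; rewrite opprK.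
rewrite /D row_st_rho1 [rho1 v 0 0]mxE /= mul1r mul_expm1_div lE.
by rewrite mulmxDr mulmx1 scalemxAr.
Qed.

Lemma extendable_mulmx (L M : 'M[C]_2) : extendable (mulmxr L) ->
  extendable (mulmxr M) -> extendable (mulmxr (L *m M)).
Proof.
move=> eL eM; have := extendable_comp eL eM.
by rewrite (_ : _ \o _ = mulmxr (L *m M))//; apply/funext => v /=; rewrite mulmxA.
Qed.

Lemma extendable_linear (L : 'M[C]_2) : L \in unitmx -> extendable (mulmxr L).
Proof.
have upper x : extendable (mulmxr (1%:M + x *: delta_mx 0 1)).
  apply: extendable_nilpotent.
  by rewrite -scalemxAl -scalemxAr mul_delta_mx_0// !scaler0.
have lower x : extendable (mulmxr (1%:M + x *: delta_mx 1 0)).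
  apply: extendable_nilpotent.
  by rewrite -scalemxAl -scalemxAr mul_delta_mx_0// !scaler0.
have sl2_10 (S : 'M[C]_2) : \det S = 1 -> S 1 0 != 0 -> extendable (mulmxr S).
  by move=> detS S10; rewrite (det1_mx22_factor detS S10);
     do 2?apply: extendable_mulmx.
have sl2 (S : 'M[C]_2) : \det S = 1 -> extendable (mulmxr S).
  move=> detS; have [S10|S10] := eqVneq (S 1 0) 0; last exact: sl2_10.
  (* Here [S 0 0] is nonzero since the determinant is [1], so adding the first row to the second
     reaches the case already treated. *)
  rewrite [S]mx22_shear_rows; apply: extendable_mulmx => //.
  apply: sl2_10; first by rewrite det_mulmx detS mulr1 det_lower_transvection.
  have -> : ((1%:M + 1 *: delta_mx 1 0) *m S) 1 0 = S 0 0.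
    by rewrite mulmx2E S10 mulr0 addr0 !mxE /= mulr1 add0r mul1r.
  apply: contra_eq_neq detS => S00.
  by rewrite det_mx22 S00 S10 mul0r mulr0 subr0 eq_sym oner_eq0.
rewrite unitmxE unitfE => L0; rewrite (mx22_dilation_factor L L0).
apply: extendable_mulmx; first exact: extendable_dilation.
by apply: sl2; rewrite det_mulmx det_dilation mulVf.
Qed.

End shears.

(** * Second-order expansions and polynomial automorphisms of the plane *)

Section expansions.
Variable R : realType.
Local Notation C := (Cplx R).
Implicit Types (A B L K : 'M[C]_2) (u v w : 'rV[C]_2).
Implicit Types (g h : 'rV[C]_2 -> 'rV[C]_2) (r s : 'M[C]_2 -> 'rV[C]_2).

(** Taylor's formula for [g (a v)] in powers of [a = A 0 0]: [k] is [g 0] and [L] the derivative at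
    the origin, acting on rows. The remainder is a function of the matrix so that it can serve as
    the displacement of a shear. *)
Definition expands g k L r : Prop :=
  (forall A, differentiable r A) /\
  forall A, g (A 0 0 *: row_st A) =
    k + A 0 0 *: (row_st A *m L) + (A 0 0 ^+ 2) *: r A.

(** The shear of [r] sends [v] to [v + a r], which is [g (a v) / a] for nonzero [a]. Applying [h] to
    [g (a v)] and cancelling [a ^+ 2] shows that [s] at the image is [- r]. *)
Lemma extendable_tangent_id g h r s :
  expands g 0 1%:M r -> expands h 0 1%:M s -> cancel g h -> cancel h g ->
  extendable g.
Proof.
have opp f e p q A : expands f 0 1%:M p -> expands e 0 1%:M q -> cancel f e ->
    A 0 0 != 0 -> q (shear p A) = - p A.
  move=> [_ fE] [_ eE] fK A0; have := fK (A 0 0 *: row_st A).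
  have := eE (shear p A); have := fE A.
  rewrite row_st_shear [shear _ _ 0 0]mxE /= !mulmx1 !add0r => ->.
  rewrite scalerDr scalerA -expr2 => -> /eqP.
  rewrite -addrA -[X in _ == X]addr0 (inj_eq (addrI _)).
  rewrite -scalerDr scaler_eq0 expf_eq0 (negbTE A0) /=.
  by rewrite addrC addr_eq0 => /eqP.
move=> ge he gK hK.
apply: (@extendable_shear _ r s); [by case: ge|by case: he| | |].
- by move=> A; exact: opp gK.
- by move=> A; exact: opp hK.
move=> v; have := ge.2 (rho1 v).
by rewrite row_st_rho1 [rho1 v 0 0]mxE /= expr1n !scale1r mulmx1 add0r.
Qed.

(** The chain rule at the origin, obtained by dividing [h (g (a v)) = a v] by [a] and passing to
    [a = 0] by density. *)
Lemma expands_cancel_mulmx g h L K r s :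
  expands g 0 L r -> expands h 0 K s -> cancel g h -> L *m K = 1%:M.
Proof.
move=> [dr gE] [ds hE] gK.
(* [B A] carries [a] and [g (a v) / a], where the expansion of [h] is read off; [F A] is
   [(h (g (a v)) - a v) / a] written without division. *)
pose B A := mx_st (A 0 0) (row_st A *m L + A 0 0 *: r A) 0.
pose F A := row_st A *m (L *m K - 1%:M) + A 0 0 *: (r A *m K + s (B A)).
have dcoord A : differentiable (fun A : 'M[C]_2 => A 0 0) A.
  exact: differentiable_coord.
have dB A : differentiable B A.
  apply: (differentiable_mx_st (dcoord A)); last exact: differentiable_cst.
  apply: differentiableD; last exact: (differentiable_scale_mx (dcoord A)).
  exact/differentiable_mulmxr/differentiable_row_st.
have F0 : forall A, F A = 0.
  apply: eq0_of_generic => A.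
    apply: differentiableD.
      exact/differentiable_mulmxr/differentiable_row_st.
    apply: (differentiable_scale_mx (dcoord A)); apply: differentiableD.
      exact: differentiable_mulmxr.
    exact: (differentiable_comp (dB A)).
  move=> A0; apply/eqP; move: (gK (A 0 0 *: row_st A)).
  have := hE (B A); rewrite row_st_mx_st [B A 0 0]mxE /= gE !add0r.
  rewrite scalerDr scalerA -expr2 => -> /eqP.
  rewrite -subr_eq0 mulmxDl -scalemxAl -mulmxA.
  suff -> : A 0 0 *: (row_st A *m (L *m K) + A 0 0 *: (r A *m K)) +
      A 0 0 ^+ 2 *: s (B A) - A 0 0 *: row_st A = A 0 0 *: F A.
    by rewrite scaler_eq0 (negbTE A0).
  rewrite /F mulmxBr mulmx1.
  move: (row_st A *m (L *m K)) (r A *m K) (s (B A)) (row_st A) (A 0 0) => x y z w a.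
  rewrite !scalerDr scalerN !scalerA -expr2.
  by rewrite !addrA [LHS]addrAC [X in X + _ = _]addrAC.
apply/eqP; rewrite -subr_eq0; apply/eqP/row_matrixP => i.
(* At [a = 0], [F] on a basis row is a row of [L *m K - 1%:M]. *)
rewrite row0 rowE; have := F0 (mx_st 0 (delta_mx 0 i) 0).
by rewrite /F row_st_mx_st [mx_st _ _ _ 0 0]mxE /= scale0r addr0.
Qed.

(** Polynomial functions given by generators, so that composition and expansion are proved by
    induction. *)
Inductive polyfun : ('rV[C]_2 -> C) -> Prop :=
| polyfun_cst c : polyfun (fun=> c)
| polyfun_coord i : polyfun (fun v => v 0 i)
| polyfunD p q : polyfun p -> polyfun q -> polyfun (fun v => p v + q v)
| polyfunM p q : polyfun p -> polyfun q -> polyfun (fun v => p v * q v).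

Definition polymap g := forall i, polyfun (fun v => g v 0 i).

Lemma polyfun_comp p g : polyfun p -> polymap g -> polyfun (fun v => p (g v)).
Proof.
move=> pp pg; elim: pp => [c|i|p1 q1 _ IHp _ IHq|p1 q1 _ IHp _ IHq].
- exact: polyfun_cst.
- exact: pg.
- exact: polyfunD.
- exact: polyfunM.
Qed.

Lemma polymap_comp g h : polymap g -> polymap h -> polymap (g \o h).
Proof. by move=> pg ph i; exact: (polyfun_comp (pg i) ph). Qed.

(** The number of variables is free: entries of an embedding are polynomials in two variables,
    regular functions on its image in four. *)
Lemma polyfun_meval n (x : 'rV[C]_2 -> 'I_n -> C) (p : mpoly.mpoly n C) :
  (forall i, polyfun (fun v => x v i)) -> polyfun (fun v => mpoly.meval (x v) p).
Proof.
move=> px; have pX i k : polyfun (fun v => x v i ^+ k).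
  elim: k => [|k IHk]; first by under eq_fun do rewrite expr0; exact: polyfun_cst.
  by under eq_fun do rewrite exprS; exact: polyfunM.
under eq_fun do rewrite mpoly.mevalE.
elim: (mpoly.msupp p) => [|m ms IH].
  by under eq_fun do rewrite big_nil; exact: polyfun_cst.
under eq_fun do rewrite big_cons.
apply: polyfunD => //; apply: polyfunM; first exact: polyfun_cst.
elim: (index_enum _) => [|i js IHj].
  by under eq_fun do rewrite big_nil; exact: polyfun_cst.
under eq_fun do rewrite big_cons.
exact: polyfunM.
Qed.

Lemma polyfun_expansion p : polyfun p ->
  exists (k : C) (l : 'cV[C]_2) (r : 'M[C]_2 -> C),
    (forall A, differentiable r A) /\
    forall A, p (A 0 0 *: row_st A) =
      k + A 0 0 * (row_st A *m l) 0 0 + A 0 0 ^+ 2 * r A.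
Proof.
have dM (f e : 'M[C]_2 -> C) A : differentiable f A -> differentiable e A ->
  differentiable (fun B => f B * e B) A by exact: differentiableM.
have dD (f e : 'M[C]_2 -> C) A : differentiable f A -> differentiable e A ->
  differentiable (fun B => f B + e B) A by exact: differentiableD.
have dC (c : C) A : differentiable (fun=> c : C) A by exact: differentiable_cst.
have dl (l : 'cV[C]_2) A : differentiable (fun B => (row_st B *m l) 0 0) A.
  apply: differentiable_entry.
  exact/differentiable_mulmxr/differentiable_row_st.
elim=> [c|i|p1 q1 _ [k [l [r [dr pE]]]] _ [k' [l' [r' [dr' qE]]]]|
        p1 q1 _ [k [l [r [dr pE]]]] _ [k' [l' [r' [dr' qE]]]]].
- exists c, 0, (fun=> 0); split=> // A.
  by rewrite mulmx0 mxE !mulr0 !addr0.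
- exists 0, (delta_mx i 0), (fun=> 0); split=> // A.
  by rewrite -colE !mxE !mulr0 addr0 add0r.
- exists (k + k'), (l + l'), (fun A => r A + r' A); split=> [A|A].
    exact: dD.
  by rewrite pE qE mulmxDr [(row_st A *m l + _) 0 0]mxE; ring.
(* The remainder collects the terms of the product of order at least two in [A 0 0], divided by
   [A 0 0 ^+ 2]. *)
- exists (k * k'), (k *: l' + k' *: l), (fun A => k * r' A + k' * r A
    + (row_st A *m l) 0 0 * (row_st A *m l') 0 0
    + A 0 0 * ((row_st A *m l) 0 0 * r' A + (row_st A *m l') 0 0 * r A)
    + A 0 0 ^+ 2 * (r A * r' A)); split=> [A|A].
    have d0 : differentiable (fun B : 'M[C]_2 => B 0 0 : C) A.
      exact: differentiable_coord.
    have d02 : differentiable (fun B : 'M[C]_2 => B 0 0 ^+ 2 : C) A.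
      by under eq_fun do rewrite expr2; exact: dM.
    apply: (dD _ _ A); last exact: (dM _ _ A d02 (dM _ _ A (dr A) (dr' A))).
    apply: (dD _ _ A); last first.
      apply: (dM _ _ A d0); apply: (dD _ _ A).
        exact: (dM _ _ A (dl l A) (dr' A)).
      exact: (dM _ _ A (dl l' A) (dr A)).
    apply: (dD _ _ A); last exact: (dM _ _ A (dl l A) (dl l' A)).
    apply: (dD _ _ A); first exact: (dM _ _ A (dC k A) (dr' A)).
    exact: (dM _ _ A (dC k' A) (dr A)).
  rewrite pE qE mulmxDr -!scalemxAr.
  have -> : (k *: (row_st A *m l') + k' *: (row_st A *m l)) 0 0 =
      k * (row_st A *m l') 0 0 + k' * (row_st A *m l) 0 0.
    by rewrite mxE [X in X + _]mxE [X in _ + X]mxE.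
  by ring.
Qed.

Lemma polymap_expands g : polymap g -> exists k L r, expands g k L r.
Proof.
move=> pg; have /choice[k hk] := fun i => polyfun_expansion (pg i).
have /choice[l hl] := hk; have /choice[r hr] := hl.
exists (\row_i k i), (\matrix_(i, j) l j i 0), (fun A => \row_i r i A).
split=> A.
  apply: differentiable_mx => i j; under eq_fun do rewrite mxE.
  by have [] := hr j.
apply/rowP => j; have [_ ->] := hr j.
by rewrite !mxE; congr (_ + _ * _ + _); apply: eq_bigr => i _; rewrite !mxE.
Qed.

(** [g] is a map tangent to the identity at the origin, followed by its derivative [L] and the
    translation by [g 0]. *)
Lemma extendable_polymap g h :
  polymap g -> polymap h -> cancel g h -> cancel h g -> extendable g.
Proof.
move=> pg ph gK hK.
pose g1 v := g v - g 0; pose h1 v := h (v + g 0).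
have g1K : cancel g1 h1 by move=> v; rewrite /g1 /h1 subrK gK.
have h1K : cancel h1 g1 by move=> v; rewrite /g1 /h1 hK addrK.
have g10 : g1 0 = 0 by rewrite /g1 subrr.
have h10 : h1 0 = 0 by rewrite /h1 add0r gK.
have expands0 f : polymap f -> f 0 = 0 -> exists L r, expands f 0 L r.
  move=> /polymap_expands[k [L [r [dr fE]]]] f0; exists L, r; split=> // A.
  rewrite fE; congr (_ + _ + _).
  by have := fE 0; rewrite mxE expr0n !scale0r !addr0 f0.
have [L [r gE]] : exists L r, expands g1 0 L r.
  apply: expands0 => // i; rewrite /g1; under eq_fun do rewrite mxE.
  by apply: polyfunD => //; exact: polyfun_cst.
have [K [s hE]] : exists K s, expands h1 0 K s.
  apply: expands0 => //; apply: polymap_comp => // i.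
  under eq_fun do rewrite mxE.
  by apply: polyfunD; [exact: polyfun_coord|exact: polyfun_cst].
have LK := expands_cancel_mulmx gE hE g1K.
have KL := expands_cancel_mulmx hE gE h1K.
have -> : g = +%R^~ (g 0) \o (mulmxr L \o (fun v => g1 v *m K)).
  by apply/funext => v; rewrite /= -mulmxA KL mulmx1 /g1 subrK.
apply: extendable_comp; last exact: extendable_translation.
apply: extendable_comp; last first.
  by apply: extendable_linear; have [] := mulmx1_unit LK.
(* The inverse of [g1] followed by [K] is [L] followed by [h1]; its remainder is [s] at the matrix
   whose row is [row_st A *m L]. *)
apply: (@extendable_tangent_id _ (fun v => h1 (v *m L)) (fun A => r A *m K)
  (fun A => s (mx_st (A 0 0) (row_st A *m L) 0))).
- split=> A; first by apply: differentiable_mulmxr; case: gE.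
  by rewrite gE.2 !add0r mulmxDl -!scalemxAl -mulmxA LK.
- split=> A.
    apply: (@differentiable_comp _ _ _ _
      (fun A => mx_st (A 0 0) (row_st A *m L) 0) s); last by case: hE.
    apply: differentiable_mx_st; [exact: differentiable_coord| |
      exact: differentiable_cst].
    exact/differentiable_mulmxr/differentiable_row_st.
  have := hE.2 (mx_st (A 0 0) (row_st A *m L) 0).
  by rewrite row_st_mx_st [mx_st _ _ _ 0 0]mxE /= -mulmxA LK scalemxAl.
- by move=> v; rewrite -mulmxA KL mulmx1 g1K.
- by move=> v; rewrite h1K -mulmxA LK mulmx1.
Qed.

End expansions.

(** * Closed embeddings with the same image as [rho1] *)

Lemma rho1_row_st_rho (R : realType) (rho : 'rV[Cplx R]_2 -> 'M[Cplx R]_2) v :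
  range rho = range (@rho1 R) -> rho1 (row_st (rho v)) = rho v.
Proof.
move=> rho_im; have : range rho (rho v) by exists v.
by rewrite rho_im => -[u _ <-]; rewrite row_st_rho1.
Qed.

Lemma embedding_polymap (R : realType) (rho : 'rV[Cplx R]_2 -> 'M[Cplx R]_2) :
  closed_embedding_C2_SL2 rho -> polymap (@row_st R \o rho).
Proof.
move=> [[_ poly] _ _] i.
have entry j k : polyfun (fun v => rho v j k).
  have [p pE] := poly j k; under eq_fun do rewrite pE.
  exact/polyfun_meval/polyfun_coord.
by case: (ord2P i) => ->; under eq_fun do rewrite mxE /=.
Qed.

(** On the common image the inverse of [rho] is polynomial in the matrix entries, and these are
    polynomial in [(s, t)] along [rho1]; composing the two gives the inverse coordinate change. *)
Lemma embedding_inverse (R : realType) (rho : 'rV[Cplx R]_2 -> 'M[Cplx R]_2) :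
  closed_embedding_C2_SL2 rho -> range rho = range (@rho1 R) ->
  exists sigma : 'rV[Cplx R]_2 -> 'rV[Cplx R]_2,
  [/\ polymap sigma, cancel (@row_st R \o rho) sigma & cancel sigma (@row_st R \o rho)].
Proof.
move=> [_ _ [sigma [poly rhoK sigmaK]]] rho_im.
have rho1_im u : range rho (rho1 u) by rewrite rho_im; exists u.
exists (sigma \o @rho1 R); split=> [i|v|u] /=; last first.
- by rewrite sigmaK// row_st_rho1.
- by rewrite (rho1_row_st_rho v rho_im) rhoK.
have [p pE] := poly i; under eq_fun do rewrite pE//.
apply: polyfun_meval => j; case/mxvec_indexP: j => j k.
under eq_fun do rewrite mxvecE rho1E mxE.
by case: (ord2P j) => ->; case: (ord2P k) => -> /=;
  do ?[exact: polyfun_cst | exact: polyfun_coord | apply: polyfunD | apply: polyfunM].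
Qed.

Theorem mainTheorem4 (R : realType) (rho rho' : 'rV[Cplx R]_2 -> 'M[Cplx R]_2)
    (rho_emb : closed_embedding_C2_SL2 rho)
    (rho'_emb : closed_embedding_C2_SL2 rho')
    (rho_im : range rho = range (@rho1 R))
    (rho'_im : range rho' = range (@rho1 R)) :
  holomorphically_equivalent rho rho'.
Proof.
have [s [ps fK sK]] := embedding_inverse rho_emb rho_im.
have [s' [ps' fK' sK']] := embedding_inverse rho'_emb rho'_im.
have pf := embedding_polymap rho_emb.
have pf' := embedding_polymap rho'_emb.
(* With [f] and [f'] the coordinate forms of [rho] and [rho'], the map to extend is [f'] after the
   inverse [s] of [f]: it carries [rho v = rho1 (f v)] to [rho1 (f' v) = rho' v]. *)
have [phi [psi [[dphi dpsi] phiK psiK detphi phiE]]] :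
    extendable ((@row_st R \o rho') \o s).
  apply: (@extendable_polymap _ _ ((@row_st R \o rho) \o s')).
  - exact: polymap_comp.
  - exact: polymap_comp.
  - exact: can_comp.
  - exact: can_comp.
have holo (f : 'M[Cplx R]_2 -> 'M[Cplx R]_2) :
    (forall A, differentiable f A) -> holomorphic_on_SL2 f.
  by move=> df A _; exists f; near=> B; split.
exists phi; split.
  split; first by move=> A; rewrite /SL2 /= detphi.
    exact: holo.
  exists psi; split=> // [A|]; last exact: holo.
  by rewrite /SL2 /= -{1}[A]psiK detphi.
move=> v; rewrite -(rho1_row_st_rho v rho_im) phiE /=.
rewrite -[row_st (rho v)]/((@row_st R \o rho) v).
by rewrite fK (rho1_row_st_rho v rho'_im).
Unshelve. all: by end_near. Qed.
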